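(* Let $f(X)=a_{0}+a_{1}X+\cdots +a_{n}X^{n}\in \mathbb{Z}[X]$, $a_{0}a_{n}\neq 0$. Suppose there exist two indices $j_{1},j_{2}\in\{0,\dots ,n\}$ with $j_{1}<\min(j_{2},n-j_{2})$, and two distinct prime numbers $p$ and $q$ such that (i) $\nu _{p}(a_{i})=0$ for all $0\le i\leq j_{1}$, $\frac{\nu _{p}(a_{i})}{i-j_{1}}>\frac{\nu _{p}(a_{n})}{n-j_{1}}$ for $j_{1}<i<n$, and $\nu _{p}(a_{n})>0$; (ii) $\nu _{q}(a_{0})>0$, $\frac{\nu _{q}(a_{i})}{j_{2}-i}>\frac{\nu _{q}(a_{0})}{j_{2}}$ for $0<i<j_{2}$, $\nu _{q}(a_{j_{2}})=0$, $\frac{\nu _{q}(a_{i})}{i-j_{2}}>\frac{\nu _{q}(a_{n})}{n-j_{2}}$ for $j_{2}<i<n$, and $\nu _{q}(a_{n})>0$; (iii) $\gcd(\nu _{p}(a_{n}),n-j_{1})=\gcd(\nu _{q}(a_{0}),j_{2})=\gcd(\nu _{q}(a_{n}),n-j_{2})=1$. Then $f$ is irreducible over $\mathbb{Q}$.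
   Context: For a prime $p$ and a nonzero integer $m$, $\nu_p(m)$ is the largest integer $i$ such that $p^i\mid m$; by convention $\nu_p(0)=\infty$ (so lower bounds on $\nu_p(a_i)$ hold automatically when $a_i=0$). *)

(* Defs.v *)
From mathcomp Require Export all_boot all_order all_algebra.
From mathcomp Require Export constructive_ereal.

Set Implicit Arguments.
Unset Strict Implicit.
Unset Printing Implicit Defensive.

Import Order.TTheory GRing.Theory Num.Theory.

Local Open Scope ring_scope.

(* Valued in [\bar rat], so that nu_p(0) = +oo and the quotients by positive
   integers in the hypotheses are ordinary extended-rational quotients. *)
Definition nu (p : nat) (m : int) : \bar rat :=
  if m == 0 then +oo%E else ((logn p (absz m))%:R)%:E.

(* Main.v *)
(* The Newton polygon of a product is the Minkowski sum of the Newton polygons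
   of the factors (Dumas). For p, the edge of f from j1 to n has no interior
   lattice point, so one factor has degree at least n - j1 and the other, H, has
   degree at most j1. For q, the polygon of f consists of two edges without
   interior lattice points, of horizontal lengths j2 and n - j2, both larger than
   j1; H can contain neither, hence is constant. *)

Require Import Defs.
From mathcomp Require Import all_boot all_order all_algebra.
From mathcomp Require Import constructive_ereal.
From mathcomp Require Import zify.

Set Implicit Arguments.
Unset Strict Implicit.

Import Order.TTheory GRing.Theory Num.Theory.

Local Open Scope ring_scope.

(* Junk value: [vp p 0 = 0], whence the nonvanishing side conditions below. *)
Local Notation vp p x := (logn p (absz x%R)).

(** * Sizes of factors and valuations of sums and convolutions *)

Lemma coef_neq0_lt_size (R : nzRingType) (F : {poly R}) (i : nat) :
  F`_i != 0 -> (i < size F)%N.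
Proof.
by move=> Fi; rewrite ltnNge; apply: contra Fi => le; rewrite nth_default.
Qed.

Lemma size_mul_succ (R : idomainType) (F G : {poly R}) (n : nat) :
  size (F * G) = n.+1 -> [/\ F != 0, G != 0 & (size F + size G = n.+2)%N].
Proof.
move=> sFG; have /andP[F0 G0] : (F != 0) && (G != 0).
  by rewrite -negb_or -mulf_eq0 -size_poly_eq0 sFG.
split=> //; move: sFG; rewrite size_mul //.
have : (0 < size F)%N by rewrite size_poly_gt0.
lia.
Qed.

Lemma dvdz_expn_logn (p k : nat) (x : int) :
  prime p -> x != 0 -> ((p ^ k)%N%:Z %| x)%Z = (k <= vp p x)%N.
Proof. by move=> pp xn0; rewrite dvdzE pfactor_dvdn // absz_gt0. Qed.

Lemma lognM_absz (p : nat) (x y : int) : x != 0 -> y != 0 ->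
  vp p (x * y) = (vp p x + vp p y)%N.
Proof. by move=> x0 y0; rewrite abszM lognM ?absz_gt0. Qed.

(** Otherwise [p ^ (v + 1)], with [v] the valuation of the sum, would divide every term and hence
    the sum. *)
Lemma logn_sum_ge (p m : nat) (c : 'I_m -> int) :
  prime p -> \sum_j c j != 0 ->
  exists2 j, c j != 0 & (vp p (c j) <= vp p (\sum_j c j))%N.
Proof.
move=> pp S0; set S := \sum_j c j in S0 *.
have [/existsP[j /andP[]]|/existsPn H] :=
  boolP [exists j, (c j != 0) && (vp p (c j) <= vp p S)%N].
  by exists j.
suff : ((p ^ (vp p S).+1)%N%:Z %| S)%Z by rewrite dvdz_expn_logn // ltnn.
apply: rpred_sum => j _; have [->|cj0] := eqVneq (c j) 0; first exact: dvdz0.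
by move: (H j); rewrite cj0 /= -ltnNge -dvdz_expn_logn.
Qed.

(** Modulo [p ^ (v + 1)], with [v] the valuation of [c i], every other term vanishes and [c i] does
    not. *)
Lemma logn_sum_dominant (p m : nat) (c : 'I_m -> int) (i : 'I_m) :
  prime p -> c i != 0 ->
  (forall j, j != i -> c j != 0 -> (vp p (c i) < vp p (c j))%N) ->
  \sum_j c j != 0 /\ vp p (\sum_j c j) = vp p (c i).
Proof.
move=> pp ci0 dom; rewrite (bigD1 i) //=; set T := \sum_(j | _) _.
have dT : ((p ^ (vp p (c i)).+1)%N%:Z %| T)%Z.
  apply: rpred_sum => j ji; have [->|cj0] := eqVneq (c j) 0; first exact: dvdz0.
  by move: (dom j ji cj0); rewrite -dvdz_expn_logn.
have nd : ~~ ((p ^ (vp p (c i)).+1)%N%:Z %| c i + T)%Z.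
  by rewrite rpredDr // dvdz_expn_logn // ltnn.
have S0 : c i + T != 0 by apply: contra nd => /eqP ->; exact: dvdz0.
split=> //; apply/eqP; rewrite eqn_leq; apply/andP; split.
  by move: nd; rewrite dvdz_expn_logn // -leqNgt.
rewrite -dvdz_expn_logn //; apply: rpredD.
  by rewrite -[_ \in _]/(_ %| _)%Z dvdz_expn_logn.
by apply: dvdz_trans dT; rewrite dvdzE dvdn_exp2l.
Qed.

Lemma logn_coefM_ge (p : nat) (F G : {poly int}) (k : nat) :
  prime p -> (F * G)`_k != 0 ->
  exists i j, [/\ (i + j)%N = k, F`_i != 0, G`_j != 0 &
    (vp p F`_i + vp p G`_j <= vp p ((F * G)`_k))%N].
Proof.
rewrite coefM => pp /(logn_sum_ge pp)[i].
rewrite mulf_eq0 negb_or => /andP[Fi Gi]; rewrite lognM_absz // => le.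
by exists i, (k - i)%N; rewrite subnKC // -ltnS.
Qed.

Lemma logn_coefM_dominant (p : nat) (F G : {poly int}) (i j : nat) :
  prime p -> F`_i != 0 -> G`_j != 0 ->
  (forall k l, (k + l = i + j)%N -> k != i -> F`_k != 0 -> G`_l != 0 ->
    (vp p F`_i + vp p G`_j < vp p F`_k + vp p G`_l)%N) ->
  (F * G)`_(i + j) != 0 /\
  vp p (F * G)`_(i + j) = (vp p F`_i + vp p G`_j)%N.
Proof.
move=> pp Fi Gj dom; rewrite coefM.
have lti : (i < (i + j).+1)%N by rewrite ltnS leq_addr.
have := @logn_sum_dominant p _ (fun k : 'I_(i + j).+1 => F`_k * G`_(i + j - k))
  (Ordinal lti) pp.
rewrite /= addKn -lognM_absz //; apply; first by rewrite mulf_neq0.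
move=> k ki; rewrite mulf_eq0 negb_or => /andP[Fk Gk]; rewrite !lognM_absz //.
by apply: dom => //; rewrite subnKC // -ltnS.
Qed.

(** * Edges of Newton polygons *)

(** Level lines have slope [- e / d], so a rising edge is detected by a negative [e]. Scaling by [d]
    keeps the form integral. *)
Definition weight (p d : nat) (e : int) (F : {poly int}) (i : nat) : int :=
  (d * vp p F`_i)%N%:Z + e * i%:Z.

(* The points (i, nu_p(F_i)) minimising the linear form (x, y) |-> d y + e x
   span an edge, possibly reduced to a vertex, of the Newton polygon of F;
   [a] and [b] are the abscissae of its endpoints. *)
Definition edge (p d : nat) (e : int) (F : {poly int}) (a b : nat) : Prop :=
  [/\ F`_a != 0, F`_b != 0, weight p d e F a = weight p d e F b &
   forall i, F`_i != 0 -> weight p d e F a <= weight p d e F i /\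
     (weight p d e F i <= weight p d e F a -> (a <= i <= b)%N)].

Lemma edge_exists (p d : nat) (e : int) (F : {poly int}) :
  F != 0 -> exists a b, edge p d e F a b.
Proof.
move=> F0; have ltn0 : ((size F).-1 < size F)%N.
  by rewrite prednK // lt0n size_poly_eq0.
have L0 : F`_(Ordinal ltn0) != 0 by rewrite -[F`_ _]/(lead_coef F) lead_coef_eq0.
have [m Fm min] := @Order.TotalTheory.arg_minP _ _ _ (Ordinal ltn0)
  (fun i : 'I_(size F) => F`_i != 0) (fun i => weight p d e F i) L0.
pose P (i : 'I_(size F)) := (F`_i != 0) && (weight p d e F i == weight p d e F m).
have Pm : P m by rewrite /P Fm eqxx.
have [a /andP[Fa /eqP wa] mina] := arg_minnP (fun i : 'I_(size F) => i : nat) Pm.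
have [b /andP[Fb /eqP wb] maxb] := arg_maxnP (fun i : 'I_(size F) => i : nat) Pm.
exists a, b; split=> //; first by rewrite wa wb.
move=> i Fi; have lti : (i < size F)%N := coef_neq0_lt_size Fi.
have wi := min (Ordinal lti) Fi; split; first by rewrite wa.
move=> le; have Pi : P (Ordinal lti).
  by rewrite /P Fi eq_le wi -wa le.
by apply/andP; split; [exact: mina Pi | exact: maxb Pi].
Qed.

Lemma edge_lt_size (p d : nat) (e : int) (F : {poly int}) (a b : nat) :
  edge p d e F a b -> (b < size F)%N.
Proof. by case=> _ Fb _ _; apply: coef_neq0_lt_size. Qed.

Lemma edge_uniq (p d : nat) (e : int) (F : {poly int}) (a b a' b' : nat) :
  edge p d e F a b -> edge p d e F a' b' -> a = a' /\ b = b'.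
Proof.
move=> [Fa Fb ab min] [Fa' Fb' ab' min'].
have [? ?] := min _ Fa'; have [? ?] := min _ Fb'.
have [? ?] := min' _ Fa; have [? ?] := min' _ Fb.
lia.
Qed.

Lemma weightM (p d : nat) (e : int) (F G : {poly int}) (i j : nat) :
  vp p (F * G)`_(i + j) = (vp p F`_i + vp p G`_j)%N ->
  weight p d e (F * G) (i + j) = weight p d e F i + weight p d e G j.
Proof. by rewrite /weight => ->; lia. Qed.

(** This is Dumas' theorem for one slope. Among pairs of indices with sum [a + a'], any pair other
    than [(a, a')] has a member left of its edge, hence a strictly larger total weight, so nothing
    cancels; the right endpoints are symmetric. *)
Lemma edgeM (p d : nat) (e : int) (F G : {poly int}) (a b a' b' : nat) :
  prime p -> edge p d e F a b -> edge p d e G a' b' ->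
  edge p d e (F * G) (a + a') (b + b').
Proof.
move=> pp [Fa Fb wF minF] [Ga' Gb' wG minG].
have lt_logn i j k l : (k + l = i + j)%N ->
    weight p d e F i + weight p d e G j < weight p d e F k + weight p d e G l ->
    (vp p F`_i + vp p G`_j < vp p F`_k + vp p G`_l)%N.
  by rewrite /weight; nia.
have [n1 v1] : (F * G)`_(a + a') != 0 /\
    vp p (F * G)`_(a + a') = (vp p F`_a + vp p (G`_a'))%N.
  apply: logn_coefM_dominant => // k l kl ki Fk Gl; apply: lt_logn => //.
  have [? ?] := minF _ Fk; have [? ?] := minG _ Gl; lia.
have [n2 v2] : (F * G)`_(b + b') != 0 /\
    vp p (F * G)`_(b + b') = (vp p F`_b + vp p (G`_b'))%N.
  apply: logn_coefM_dominant => // k l kl ki Fk Gl; apply: lt_logn => //.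
  have [? ?] := minF _ Fk; have [? ?] := minG _ Gl; lia.
split=> //; first by rewrite !weightM // wF wG.
(* Some pair [(i, j)] with sum [k] bounds the weight at [k] from below; if that weight is minimal,
   [i] and [j] both lie within their edges. *)
move=> k nk; have [i [j [ij Fi Gj le]]] := logn_coefM_ge pp nk.
have wk : weight p d e F i + weight p d e G j <= weight p d e (F * G) k.
  by rewrite /weight; nia.
rewrite weightM //; have [? ?] := minF _ Fi; have [? ?] := minG _ Gj; lia.
Qed.

(** Equal weights at the endpoints make [d] divide [e * (b - a)], and [d] is coprime to [e]. *)
Lemma edge_dvd (p d : nat) (e : int) (F : {poly int}) (a b : nat) :
  coprime d `|e| -> edge p d e F a b -> (a <= b)%N /\ (d %| b - a)%N.
Proof.
move=> cde [Fa Fb wab min]; have [_ ab] := min _ Fa.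
have {}ab : (a <= b)%N by have := ab (lexx _); lia.
split=> //; rewrite -(Gauss_dvdr _ cde); apply/dvdnP.
exists `|(vp p F`_a)%:Z - (vp p F`_b)%:Z|%N.
by move: wab; rewrite /weight; nia.
Qed.

(** Convexity: a falling edge lies to the left of a rising one. If [a' < b], the first form makes
    the valuation at [b] smaller than at [a'], and the second makes it larger. *)
Lemma edge_leq (p d d' V V' : nat) (F : {poly int}) (a b a' b' : nat) :
  (0 < V)%N -> (0 < V')%N ->
  edge p d V F a b -> edge p d' (- V'%:Z) F a' b' -> (b <= a')%N.
Proof.
move=> V0 V'0 [Fa Fb wab min] [Fa' Fb' wab' min'].
have [le _] := min _ Fa'; have [le' _] := min' _ Fb.
rewrite leqNgt; apply/negP => ltab; move: le le'; rewrite wab /weight.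
move: (vp p F`_b) (vp p F`_a') => x y le le'.
have xy : (x < y)%N by nia.
have : (0 < V' * (b - a'))%N by rewrite muln_gt0 V'0 subn_gt0.
have : (d' * x <= d' * y)%N by rewrite leq_mul2l ltnW ?orbT.
nia.
Qed.

(** * Edges given by the slope hypotheses, and their effect on factors *)

(** The slope condition puts the intermediate points strictly above the chord from [(j, 0)] to
    [(n, vp p F_n)]. Left of [j] the linear term alone exceeds the minimum. *)
Lemma edge_right (p n j : nat) (F : {poly int}) :
  size F = n.+1 -> (j < n)%N -> F`_j != 0 -> vp p F`_j = 0%N ->
  (0 < vp p F`_n)%N ->
  (forall i, (j < i < n)%N -> F`_i != 0 ->
    (vp p F`_n * (i - j) < vp p F`_i * (n - j))%N) ->
  edge p (n - j) (- (vp p F`_n)%:Z) F j n.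
Proof.
move=> sF jn Fj vj vn slope.
have Fn : F`_n != 0.
  by rewrite -[n]/(n.+1.-1) -sF -[F`_ _]/(lead_coef F) lead_coef_eq0
    -size_poly_eq0 sF.
have wj i : (i < j)%N ->
    - (vp p F`_n)%:Z * j%:Z < - (vp p F`_n)%:Z * i%:Z.
  by move=> ij; rewrite !mulNr ltrN2 ltr_pM2l ltz_nat.
split=> //; first by rewrite /weight vj; nia.
move=> i Fi; have lei : (i < n.+1)%N.
  by rewrite -sF coef_neq0_lt_size.
have [ij|ij|->] := ltngtP i j; last by split=> //; lia.
  by have := wj _ ij; rewrite /weight vj; nia.
have [in_|in_|->] := ltngtP i n; [|lia|by rewrite /weight vj; nia].
have := slope i; rewrite ij in_ => /(_ isT Fi); rewrite /weight vj; nia.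
Qed.

Lemma edge_left (p j : nat) (F : {poly int}) :
  (0 < j)%N -> F`_0 != 0 -> F`_j != 0 -> vp p F`_j = 0%N ->
  (0 < vp p F`_0)%N ->
  (forall i, (0 < i < j)%N -> F`_i != 0 ->
    (vp p F`_0 * (j - i) < vp p F`_i * j)%N) ->
  edge p j (vp p F`_0) F 0 j.
Proof.
move=> j0 F0 Fj vj v0 slope; split=> //; first by rewrite /weight vj; nia.
move=> [|i] Fi; first by split=> //; lia.
have [ij|ij|->] := ltngtP i.+1 j; [|rewrite /weight; nia|rewrite /weight vj; nia].
have := slope i.+1; rewrite ij => /(_ isT Fi); rewrite /weight; nia.
Qed.

Lemma nu_neq0 (p : nat) (x : int) : x != 0 -> nu p x = ((vp p x)%:R)%:E.
Proof. by rewrite /nu => /negPf ->. Qed.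

Lemma nu_eq0 (p : nat) (x : int) :
  nu p x = 0%E -> x != 0 /\ vp p x = 0%N.
Proof.
rewrite /nu; case: ifP => // _ [] /eqP; rewrite pnatr_eq0 => /eqP ->.
by [].
Qed.

Lemma nu_gt0 (p : nat) (x : int) : x != 0 -> (0 < nu p x)%E ->
  (0 < vp p x)%N.
Proof. by move=> x0; rewrite nu_neq0 // lte_fin ltr0n. Qed.

Lemma nu_div_lt (p : nat) (x y : int) (a b : nat) :
  x != 0 -> y != 0 -> (0 < a)%N -> (0 < b)%N ->
  (nu p x / (a%:R)%:E < nu p y / (b%:R)%:E)%E ->
  (vp p x * b < vp p y * a)%N.
Proof.
move=> x0 y0 a0 b0; rewrite !nu_neq0 // !inver !pnatr_eq0 !gtn_eqF //.
rewrite -!EFinM lte_fin ltr_pdivrMr ?ltr0n // mulrAC.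
by rewrite ltr_pdivlMr ?ltr0n // -!natrM ltr_nat.
Qed.

(* [H] is too short to contain either q-edge, so both its edges reduce to
   vertices, at abscissae [0] and [deg H]. By [edge_leq] for [G] and for [H], the
   equality [j = j] of the summed inner endpoints is an equality termwise, which
   makes those two vertices coincide. *)
Lemma size_small_factor (q j n V V' : nat) (G H : {poly int}) :
  prime q -> (0 < V)%N -> (0 < V')%N -> coprime j V -> coprime (n - j) V' ->
  size (G * H) = n.+1 ->
  edge q j V (G * H) 0 j -> edge q (n - j) (- V'%:Z) (G * H) j n ->
  (size H <= minn j (n - j))%N -> size H = 1%N.
Proof.
move=> pq V0 V'0 cV cV' sGH eL eR small.
have [G0 H0 sz] : [/\ G != 0, H != 0 & (size G + size H = n.+2)%N].
  exact: size_mul_succ.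
have [aL [bL eGL]] := edge_exists q j V G0.
have [cL [dL eHL]] := edge_exists q j V H0.
have [aR [bR eGR]] := edge_exists q (n - j) (- V'%:Z) G0.
have [cR [dR eHR]] := edge_exists q (n - j) (- V'%:Z) H0.
have [sum_aL sum_bL] := edge_uniq (edgeM pq eGL eHL) eL.
have [sum_aR sum_bR] := edge_uniq (edgeM pq eGR eHR) eR.
have abs_V : coprime j `|V%:Z| by [].
have leG := edge_leq V0 V'0 eGL eGR; have leH := edge_leq V0 V'0 eHL eHR.
have [leL dvL] := edge_dvd abs_V eHL.
have [leR dvR] : (cR <= dR)%N /\ (n - j %| dR - cR)%N.
  by apply: edge_dvd eHR; rewrite abszN.
have ltdL := edge_lt_size eHL; have ltdR := edge_lt_size eHR.
have ltbR := edge_lt_size eGR.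
have lenL : (dL - cL = 0)%N.
  by have [//|pos] := posnP (dL - cL)%N; have := dvdn_leq pos dvL; lia.
have lenR : (dR - cR = 0)%N.
  by have [//|pos] := posnP (dR - cR)%N; have := dvdn_leq pos dvR; lia.
(* Termwise equality gives [dL = cR], so [cL = dL = cR = dR = 0]. Hence [bR = n], which forces
   [size G] to be at least [n + 1]. *)
lia.
Qed.

(** The edge lengths [b - a] and [d - c] are multiples of [n - j] with sum [n - j], so one factor
    carries the whole edge and has degree at least [n - j]. *)
Lemma edge_factor_size (p j n V : nat) (G H : {poly int}) :
  prime p -> (j < n)%N -> coprime (n - j) V -> size (G * H) = n.+1 ->
  edge p (n - j) (- V%:Z) (G * H) j n ->
  (size G <= j.+1)%N \/ (size H <= j.+1)%N.
Proof.
move=> pp jn cV sGH e.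
have [G0 H0 sz] : [/\ G != 0, H != 0 & (size G + size H = n.+2)%N].
  exact: size_mul_succ.
have [a [b eG]] := edge_exists p (n - j) (- V%:Z) G0.
have [c [d eH]] := edge_exists p (n - j) (- V%:Z) H0.
have [sum1 sum2] := edge_uniq (edgeM pp eG eH) e.
have cV' : coprime (n - j) `|- V%:Z| by rewrite abszN.
have [leG dvG] := edge_dvd cV' eG; have [leH dvH] := edge_dvd cV' eH.
have ltb := edge_lt_size eG; have ltd := edge_lt_size eH.
have [zG|posG] := posnP (b - a)%N; last by have := dvdn_leq posG dvG; lia.
have [zH|posH] := posnP (d - c)%N; last by have := dvdn_leq posH dvH; lia.
lia.
Qed.

(* The gcd conditions only involve the nonzero coefficients a_0 and a_n, whose
   valuations [nu] are the natural numbers [logn]. *)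
Theorem theorem1p32 (f : {poly int}) (n : nat)
  (deg_f : size f = n.+1) (a0_neq0 : f`_0 != 0)
  (j1 j2 : nat) (j1_le_n : (j1 <= n)%N) (j2_le_n : (j2 <= n)%N)
  (j1_lt : (j1 < minn j2 (n - j2))%N)
  (p q : nat) (p_prime : prime p) (q_prime : prime q) (p_neq_q : p != q)
  (p_low : forall i : nat, (i <= j1)%N -> nu p f`_i = 0%E)
  (p_slope : forall i : nat, (j1 < i < n)%N ->
     (nu p f`_n / ((n - j1)%N%:R)%:E < nu p f`_i / ((i - j1)%N%:R)%:E)%E)
  (p_an : (0 < nu p f`_n)%E)
  (q_a0 : (0 < nu q f`_0)%E)
  (q_slope_left : forall i : nat, (0 < i < j2)%N ->
     (nu q f`_0 / (j2%:R)%:E < nu q f`_i / ((j2 - i)%N%:R)%:E)%E)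
  (q_aj2 : nu q f`_j2 = 0%E)
  (q_slope_right : forall i : nat, (j2 < i < n)%N ->
     (nu q f`_n / ((n - j2)%N%:R)%:E < nu q f`_i / ((i - j2)%N%:R)%:E)%E)
  (q_an : (0 < nu q f`_n)%E)
  (p_gcd : gcdn (logn p (absz f`_n)) (n - j1) = 1%N)
  (q_gcd_left : gcdn (logn q (absz f`_0)) j2 = 1%N)
  (q_gcd_right : gcdn (logn q (absz f`_n)) (n - j2) = 1%N) :
  irreducible_poly (map_poly intr f : {poly rat}).
Proof.
have [j1j2 j1n2] : (j1 < j2 /\ j1 < n - j2)%N by apply/andP; rewrite -leq_min.
have fn0 : f`_n != 0.
  by rewrite -[n]/(n.+1.-1) -deg_f -[f`_ _]/(lead_coef f) lead_coef_eq0
    -size_poly_eq0 deg_f.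
have [fj1 vj1] := nu_eq0 (p_low _ (leqnn j1)).
have [fj2 vj2] := nu_eq0 q_aj2.
have ep : edge p (n - j1) (- (vp p f`_n)%:Z) f j1 n.
  apply: edge_right => //; [lia | exact: nu_gt0 |].
  move=> i ij fi; apply: nu_div_lt (p_slope i ij) => //; lia.
have eR : edge q (n - j2) (- (vp q f`_n)%:Z) f j2 n.
  apply: edge_right => //; [lia | exact: nu_gt0 |].
  move=> i ij fi; apply: nu_div_lt (q_slope_right i ij) => //; lia.
have eL : edge q j2 (vp q f`_0) f 0 j2.
  apply: edge_left => //; [lia | exact: nu_gt0 |].
  move=> i ij fi; apply: nu_div_lt (q_slope_left i ij) => //; lia.
(* The [q]-edges leave no nonconstant factor of degree at most [j1]. *)
have small G H : f = G * H -> (size H <= j1.+1)%N -> size H = 1%N.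
  move=> fGH sH; rewrite fGH in deg_f eL eR.
  apply: size_small_factor eL eR _ => //; rewrite -?fGH //.
  - exact: nu_gt0.
  - exact: nu_gt0.
  - by rewrite coprime_sym; apply/eqP.
  - by rewrite coprime_sym; apply/eqP.
  - exact: leq_trans sH j1_lt.
have size_intr (F : {poly int}) : size (map_poly intr F : {poly rat}) = size F.
  by apply: size_map_inj_poly => //; exact: intr_inj.
split; first by rewrite size_intr deg_f; lia.
move=> g g1 gf; rewrite -(dvdp_size_eqp gf).
(* Gauss's lemma: up to a rational scalar, [g] is an integer polynomial dividing [f] over the
   integers. *)
have [G [c c0 gG] [H fGH]] := dvdpP_rat_int gf.
have sg : size g = size G by rewrite gG size_scale // size_intr.
rewrite sg size_intr.
have [sG|sH] : (size G <= j1.+1)%N \/ (size H <= j1.+1)%N.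
  rewrite fGH in deg_f ep; apply: edge_factor_size ep => //; first lia.
  by rewrite -fGH coprime_sym; apply/eqP.
(* A short [G] would be constant, against the assumption on [g]; a short [H] is constant, so [G] has
   the size of [f]. *)
- by move: g1; rewrite sg (small H G) ?fGH 1?mulrC.
- have sH1 := small _ _ fGH sH.
  have G0 : G != 0 by apply: contraTneq fn0 => G0; rewrite fGH G0 mul0r coef0.
  have H0 : H != 0 by rewrite -size_poly_eq0 sH1.
  by rewrite fGH size_mul // sH1 addn1.
Qed.
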